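(* Let $m,n\ge 2$ be integers that are both odd. Then the number of spanning trees of $\mathrm{OC}_{m,n}$ is exactly $4$ times the number of spanning trees of $\mathrm{EC}_{m,n}$.
   Context: For integers $m,n\ge 1$, consider the graph on the vertex set $\{(x,y)\in\mathbb{Z}^2 : 1\le x\le m,\ 1\le y\le n\}$ in which $(x,y)$ is adjacent to $(x',y')$ if and only if $|x-x'|=|y-y'|=1$. $\mathrm{EC}_{m,n}$ is its induced subgraph on the vertices with $x+y$ even, and $\mathrm{OC}_{m,n}$ is its induced subgraph on the vertices with $x+y$ odd. *)

(* Defs.v *)
From mathcomp Require Import all_boot all_order all_algebra.

Set Implicit Arguments.
Unset Strict Implicit.
Unset Printing Implicit Defensive.

Record sgraph := SGraph {
  vertex :> finType;
  adj : rel vertex;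
  adj_sym : symmetric adj;
  adj_irrefl : irreflexive adj }.

Definition edges (G : sgraph) : {set {set G}} :=
  [set A | [exists x : G, exists y : G, adj x y && (A == [set x; y])]].

Definition connected (G : sgraph) : bool :=
  (0 < #|G|) && [forall x : G, forall y : G, connect (@adj G) x y].

(* A cycle is a cyclic sequence of at least three distinct vertices. Since the
   vertices are distinct, bounding its length by #|G| loses nothing
   (see acyclicP). *)
Definition acyclic (G : sgraph) : bool :=
  [forall k : 'I_#|G|.+1, forall c : k.-tuple G,
    (2 < k) ==> ~~ ucycleb (@adj G) c].

Lemma acyclicP (G : sgraph) :
  reflect (forall c : seq G, 2 < size c -> ~~ ucycleb (@adj G) c) (acyclic G).
Proof.
apply: (iffP forallP) => [acG c c_gt2 | acG k].
  apply/negP => uc; have /andP[_ /card_uniqP cE] := uc.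
  have c_lt : size c < #|G|.+1 by rewrite ltnS -cE max_card.
  have /forallP/(_ (in_tuple c)) := acG (Ordinal c_lt).
  by rewrite /= c_gt2 /= uc.
by apply/forallP => c; apply/implyP => k_gt2; apply: acG; rewrite size_tuple.
Qed.

Definition is_tree (G : sgraph) : bool := connected G && acyclic G.

Section EdgeSubgraph.
Variables (G : sgraph) (F : {set {set G}}).

Definition edge_adj : rel G := fun x y => (x != y) && ([set x; y] \in F).

Lemma edge_adj_sym : symmetric edge_adj.
Proof. by move=> x y; rewrite /edge_adj eq_sym setUC. Qed.

Lemma edge_adj_irrefl : irreflexive edge_adj.
Proof. by move=> x; rewrite /edge_adj eqxx. Qed.

Definition edge_subgraph : sgraph := SGraph edge_adj_sym edge_adj_irrefl.

End EdgeSubgraph.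

(* A spanning tree is identified with its edge set. *)
Definition spanning_trees (G : sgraph) : {set {set {set G}}} :=
  [set F : {set {set G}} | (F \subset edges G) && is_tree (edge_subgraph F)].

Section Induced.
Variables (G : sgraph) (P : pred G).

Definition induced_adj : rel {v : G | P v} := fun u v => adj (val u) (val v).

Lemma induced_adj_sym : symmetric induced_adj.
Proof. by move=> u v; apply: adj_sym. Qed.

Lemma induced_adj_irrefl : irreflexive induced_adj.
Proof. by move=> u; apply: adj_irrefl. Qed.

Definition induced : sgraph := SGraph induced_adj_sym induced_adj_irrefl.

End Induced.

Section DiagonalGrid.
Variables m n : nat.

(* The ordinal i : 'I_m stands for the coordinate i.+1 in {1, ..., m}. *)
Definition coordx (v : 'I_m * 'I_n) : nat := v.1.+1.
Definition coordy (v : 'I_m * 'I_n) : nat := v.2.+1.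

(* The subtraction is that of int: these are absolute differences. *)
Definition diag_adj : rel ('I_m * 'I_n)%type := fun u v =>
  (`|coordx u - coordx v|%N == 1) && (`|coordy u - coordy v|%N == 1).

Lemma diag_adj_sym : symmetric diag_adj.
Proof. by move=> u v; rewrite /diag_adj !(distnC (_ u)). Qed.

Lemma diag_adj_irrefl : irreflexive diag_adj.
Proof. by move=> u; rewrite /diag_adj !distnn. Qed.

Definition diag_grid : sgraph := SGraph diag_adj_sym diag_adj_irrefl.

Definition EC : sgraph :=
  @induced diag_grid [pred v | ~~ odd (coordx v + coordy v)].
Definition OC : sgraph :=
  @induced diag_grid [pred v | odd (coordx v + coordy v)].

End DiagonalGrid.

(* Main.v *)
Require Import Defs.
From mathcomp Require Import all_boot all_order all_algebra all_fingroup.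
From mathcomp Require Import zify ring.

Set Implicit Arguments.
Unset Strict Implicit.
Unset Printing Implicit Defensive.

(** Write m = 2k+1 and n = 2l+1. The path on m vertices is bipartite, with a
part P of k+1 odd positions and a part Q of k even positions; likewise P' and
Q' for the path on n vertices. A diagonal move is a simultaneous step in both
paths, so EC lives on P x P' and Q x Q', OC lives on P x Q' and Q x P', and in
both graphs the adjacency matrix and the degrees are products of those of the
two paths.

Let N be the transition matrix of the simple random walk on a graph with
degree matrix D and adjacency matrix A, so that D N = A. The linear coefficient
in t of det ((t + 1) D - A) is the sum of the degrees times the number of
spanning trees (laplacian_poly_coef1). This weighted matrix-tree theorem is
obtained by expanding the determinant along its rows into a sum over self-maps
f of the vertex set: the term of f survives exactly when every vertex is driven
by f to a fixed point (fdet_rooted_forests). Those f with a single fixed point r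
that move every other vertex along an edge are the parent maps of the spanning
trees rooted at r (card_parent_maps).

For the bipartite tensor graphs, Schur complements reduce det (s - N) to a
determinant involving only the return matrices of the two factors. The
nontrivial spectrum of a return matrix does not depend on the part from which
one starts, so EC and OC yield the same determinant up to a power of s
(fdet_tensor). Counting dimensions, that power is
(|P| - |Q|) (|P'| - |Q'|) = 1, that is

  det (s - N_EC) = s det (s - N_OC).

At s = t + 1, where det (s - N_OC) has no constant term, both sides have the
same linear coefficient. The sums of the degrees being equal too, the two
numbers of spanning trees are in the ratio of the products of the degrees
(spanning_trees_tensor_flip). In a path every degree is 2 except at the two
ends, which lie in P; hence the two products are powers of 2, and the exponent
for OC exceeds the exponent for EC by 2. *)

(** * Determinants of matrices indexed by a finite type *)

Section FiniteTypeDeterminants.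
Import GRing.Theory.
Local Open Scope ring_scope.

Definition fdet (R : comNzRingType) (T : finType) (M : T -> T -> R) : R :=
  \det (\matrix_(i < #|T|, j < #|T|) M (enum_val i) (enum_val j)).

Lemma eq_fdet (R : comNzRingType) (T : finType) (M N : T -> T -> R) :
  (forall x y, M x y = N x y) -> fdet M = fdet N.
Proof.
by move=> eqMN; congr (\det _); apply/matrixP => i j; rewrite !mxE eqMN.
Qed.

(** A change of numbering permutes the rows and the columns by the same
permutation, whose sign occurs twice. *)
Lemma fdet_enum (R : comNzRingType) (T : finType) (M : T -> T -> R) n
    (g : 'I_n -> T) :
  bijective g -> fdet M = \det (\matrix_(i, j) M (g i) (g j)).
Proof.
move=> bij_g; have nE : n = #|T| by rewrite -(bij_eq_card bij_g) card_ord.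
move: g bij_g; rewrite nE => g bij_g.
have inj_s : injective (enum_rank \o g).
  by apply: inj_comp (bij_inj bij_g); apply: enum_rank_inj.
pose s := perm inj_s; rewrite /fdet; set A := (X in \det X = _).
rewrite (_ : (\matrix_(i, j) _) = row_perm s (col_perm s A)); last first.
  by apply/matrixP => i j; rewrite !mxE !permE /= !enum_rankK.
rewrite row_permE col_permE !det_mulmx !det_perm mulrCA -signr_addb.
by rewrite odd_permV addbb mulr1.
Qed.

Lemma fdet_reindex (R : comNzRingType) (T U : finType) (h : T -> U)
    (M : U -> U -> R) :
  bijective h -> fdet M = fdet (fun x y => M (h x) (h y)).
Proof.
move=> bij_h; have bij_g := bij_comp bij_h (enum_val_bij T).
by rewrite (fdet_enum M bij_g).
Qed.

Lemma fdet_scale_rows (R : comNzRingType) (T : finType) (c : T -> R)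
    (M : T -> T -> R) :
  fdet (fun x y => c x * M x y) = (\prod_x c x) * fdet M.
Proof.
pose d := \row_(i < #|T|) c (enum_val i); rewrite /fdet.
set A := (X in _ = _ * \det X).
rewrite (_ : (\matrix_(i, j) _) = diag_mx d *m A); last first.
  by apply/matrixP => i j; rewrite mul_diag_mx !mxE.
rewrite det_mulmx det_diag; congr (_ * _).
rewrite [RHS](reindex _ (onW_bij _ (enum_val_bij T))).
by apply: eq_bigr => i _; rewrite mxE.
Qed.

(** Multilinearity in the rows: a summand is chosen in each of them. *)
Lemma fdet_sum_rows (R : comNzRingType) (T : finType) (M : T -> T -> T -> R) :
  fdet (fun x y => \sum_z M x z y)
    = \sum_(f : {ffun T -> T}) fdet (fun x y => M x (f x) y).
Proof.
rewrite /fdet /determinant exchange_big /=; apply: eq_bigr => s _.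
rewrite -mulr_sumr; congr (_ * _).
pose N x y := M x y (enum_val (s (enum_rank x))).
have prodE (f : T -> T) : \prod_x N x (f x) = \prod_(i < #|T|)
    M (enum_val i) (f (enum_val i)) (enum_val (s i)).
  rewrite (reindex _ (onW_bij _ (enum_val_bij T))).
  by apply: eq_bigr => i _; rewrite /N enum_valK.
transitivity (\prod_x \sum_y N x y).
  rewrite [RHS](reindex _ (onW_bij _ (enum_val_bij T))).
  apply: eq_bigr => i _; rewrite mxE; apply: eq_bigr => y _.
  by rewrite /N enum_valK.
rewrite bigA_distr_bigA; apply: eq_bigr => f _; rewrite prodE.
by apply: eq_bigr => i _; rewrite mxE.
Qed.

End FiniteTypeDeterminants.

(** * Expansion of Laplacian determinants over rooted forests *)

Section Forests.
Import GRing.Theory.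
Local Open Scope ring_scope.

(** Fixed points are the roots of the forest; they are its only cycles. *)
Definition forest (T : finType) (f : T -> T) : bool :=
  [forall x, exists y, (f y == y) && fconnect f x y].

(** A vertex moved by [s] is sent to its image under [f], which injectivity
forces to be moved too; its forward orbit then never meets a fixed point. *)
Lemma forest_perm1 (T : finType) (f s : T -> T) :
    forest f -> injective s -> (forall x, s x = x \/ s x = f x) ->
  forall x, s x = x.
Proof.
move=> /forallP forf inj_s sE x; apply/eqP/negPn/negP => sx.
have moved k : s (iter k f x) != iter k f x.
  elim: k => [|k IHk] //=; have [sk|<-] := sE (iter k f x).
    by rewrite sk eqxx in IHk.
  by apply: contra IHk => /eqP/inj_s/eqP.
have /existsP[y /andP[/eqP fy /iter_findex xy]] := forf x.
have := moved (findex f x y); rewrite xy.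
by case: (sE y) => ->; rewrite ?fy eqxx.
Qed.

(** Let F be the matrix of [f], with zero rows at the fixed points. For a forest,
[forest_perm1] leaves only the identity in the Leibniz expansion of
det (1 - F). Otherwise the indicator of the set of vertices that never reach a
fixed point is a nonzero vector in the kernel of 1 - F. *)
Lemma fdet_forest (R : comNzRingType) (T : finType) (f : T -> T) :
  fdet (fun x y => (y == x)%:R - (f x != x)%:R * (y == f x)%:R : R)
    = (forest f)%:R.
Proof.
have [forf | nforf] := boolP (forest f).
  (* the identity contributes 1: an entry of F on the diagonal would come from a
     fixed point, where the row of F is zero *)
  rewrite /fdet /determinant (bigD1 1%g) //= odd_perm1 mul1r.
  rewrite [X in _ + X]big1 ?addr0 => [|s /eqP s_neq1].
    apply: big1 => i _; rewrite mxE perm1 eqxx.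
    by rewrite (eq_sym (enum_val i)); case: eqP => _; rewrite ?mul0r ?mulr0 subr0.
  apply/eqP; apply: contraT => prod_neq0; case: s_neq1.
  pose t x := enum_val (s (enum_rank x)).
  have t1 : forall x, t x = x.
    apply: (forest_perm1 forf) => [|x].
      by move=> x y /enum_val_inj/perm_inj/enum_rank_inj.
    have [tx | ntx] := eqVneq (t x) x; first by left.
    have [tfx | ntfx] := eqVneq (t x) (f x); first by right.
    case/eqP: prod_neq0; rewrite (bigD1 (enum_rank x)) //= mxE enum_rankK.
    by rewrite -/(t x) (negPf ntx) (negPf ntfx) mulr0 subrr mul0r mulr0.
  apply/permP => i; rewrite perm1; apply: enum_val_inj.
  by have := t1 (enum_val i); rewrite /t enum_valK.
move: nforf; rewrite negb_forall => /existsP[x0 bad_x0].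
pose bad x := ~~ [exists y, (f y == y) && fconnect f x y].
have bad_fix x : f x = x -> bad x = false.
  move=> fx; apply/negbTE; rewrite negbK; apply/existsP; exists x.
  by rewrite fx eqxx connect0.
have bad_step x : f x != x -> bad (f x) = bad x.
  move=> fx; rewrite /bad; congr (~~ _).
  apply: eq_existsb => y; have [fy|] := eqVneq (f y) y; rewrite ?andbF //=.
  have [xy | xy] := eqVneq x y; first by rewrite -xy in fy; rewrite fy eqxx in fx.
  apply/idP/idP => [|/iter_findex]; first by apply/connect_trans/fconnect1.
  case: (findex f x y) => [/eqP/(elimT eqP)//|k]; first by move/eqP: xy.
  by rewrite iterSr => <-; apply: fconnect_iter.
pose v : 'cV[R]_#|T| := \col_i (bad (enum_val i))%:R.
rewrite /fdet; set A := \matrix_(i, j) _.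
have Av : A *m v = 0.
  apply/matrixP => i k; rewrite mxE [RHS]mxE.
  transitivity (\sum_y ((y == enum_val i)%:R
    - (f (enum_val i) != enum_val i)%:R * (y == f (enum_val i))%:R : R)
      * (bad y)%:R).
    rewrite [RHS](reindex _ (onW_bij _ (enum_val_bij T))).
    by apply: eq_bigr => j _; rewrite !mxE.
  under eq_bigr do rewrite mulrBl.
  rewrite sumrB (bigD1 (enum_val i)) //= eqxx mul1r.
  rewrite big1 ?addr0 => [|y /negPf->]; last by rewrite mul0r.
  rewrite (bigD1 (f (enum_val i))) //= eqxx mulr1.
  rewrite big1 ?addr0 => [|y /negPf->]; last by rewrite mulr0 mul0r.
  have [fi | /bad_step->] := eqVneq (f (enum_val i)) (enum_val i).
    by rewrite bad_fix // mul0r subr0.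
  by rewrite mul1r subrr.
(* over a ring with zero divisors, the adjugate turns A v = 0 into det A = 0 *)
have: \adj A *m A *m v = 0 by rewrite -mulmxA Av mulmx0.
rewrite mul_adj_mx mul_scalar_mx => /matrixP/(_ (enum_rank x0) 0).
by rewrite !mxE enum_rankK /bad bad_x0 mulr1.
Qed.

(** Row [x] of the matrix is the sum over [z] of the weight of the arc from [x] to
[z] times the difference of the basis vectors of [x] and [z], the loop at [x]
standing for a root of weight [c x] and contributing the basis vector of [x]
alone. The expansion over rows chooses one arc out of each vertex. *)
Theorem fdet_rooted_forests (R : comNzRingType) (T : finType)
    (c : T -> R) (w : T -> T -> R) :
  fdet (fun x y => (y == x)%:R * (c x + \sum_z w x z) - w x y)
    = \sum_(f : {ffun T -> T} | forest f)
        \prod_x (if f x == x then c x else w x (f x)).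
Proof.
(* the root weight [c x] replaces the weight [w x x], which cancels on the
   diagonal of the matrix *)
pose b x z := if z == x then c x else w x z.
pose q (x z y : T) : R := (y == x)%:R - (z != x)%:R * (y == z)%:R.
rewrite (@eq_fdet _ _ _ (fun x y => \sum_z b x z * q x z y))
  => [|x y]; last first.
  have -> : \sum_z w x z = w x x + \sum_(z | z != x) w x z by rewrite (bigD1 x).
  rewrite [RHS](bigD1 x) //= /b /q eqxx mul0r subr0.
  under [in RHS]eq_bigr => z /negPf zx do rewrite zx mul1r mulrBr.
  rewrite sumrB -mulr_suml; have [->|yx] := eqVneq y x.
    rewrite !mulr1 mul1r [\sum_(_ | _) _ * _]big1 => [|z zx].
      by rewrite subr0 addrCA [w x x + _]addrC addrK.
    by rewrite eq_sym (negPf zx) mulr0.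
  rewrite !mulr0 mul0r !sub0r (bigD1 y) //= eqxx mulr1 big1 ?addr0 // => z.
  by case/andP=> _ zy; rewrite eq_sym (negPf zy) mulr0.
rewrite fdet_sum_rows [RHS]big_mkcond /=; apply: eq_bigr => f _.
by rewrite fdet_scale_rows fdet_forest; case: forest; rewrite ?mulr1 ?mulr0.
Qed.

End Forests.

(** * Spanning trees as parent maps *)

Section ParentMaps.
Variable G : sgraph.
Implicit Types (r x y : G) (f g : {ffun G -> G}) (F : {set {set G}}).

(** A spanning tree rooted at [r], encoded by the map sending each vertex to the
next one on its way to [r]; fixing [r] makes the encoding unique. *)
Definition parent_map r f : bool :=
  [forall x, (if x == r then f x == x else adj x (f x)) && fconnect f x r].

Definition parent_edges r f : {set {set G}} :=
  [set [set x; f x] | x in [set~ r]].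

Lemma parent_root r f : parent_map r f -> f r = r.
Proof. by move/forallP/(_ r); rewrite eqxx => /andP[/eqP]. Qed.

Lemma parent_adj r f x : parent_map r f -> x != r -> adj x (f x).
Proof. by move/forallP/(_ x) => + /negPf xr; rewrite xr => /andP[]. Qed.

Lemma parent_neq r f x : parent_map r f -> x != r -> f x != x.
Proof.
move=> pf xr; have := parent_adj pf xr.
by apply: contraTneq => ->; rewrite adj_irrefl.
Qed.

Lemma parent_depth r f x :
  parent_map r f -> x != r -> findex f x r = (findex f (f x) r).+1.
Proof.
by move=> /forallP/(_ x)/andP[_ fxr] xr; rewrite fconnect_findex // eq_sym.
Qed.

(** Induction on the depth of a vertex in the tree. *)
Lemma parent_ind r f (P : G -> Prop) : parent_map r f -> P r ->
  (forall x, x != r -> P (f x) -> P x) -> forall x, P x.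
Proof.
move=> pf Pr IH x; have [n] := ubnP (findex f x r); elim: n x => // n IHn x.
have [-> //|xr] := eqVneq x r.
by rewrite (parent_depth pf xr) ltnS => /IHn; apply: IH.
Qed.

Lemma eq_set2 (T : finType) (a b c d : T) :
  ([set a; b] == [set c; d])
    = (a == c) && (b == d) || (a == d) && (b == c).
Proof.
apply/eqP/orP => [E | [] /andP[/eqP-> /eqP->] //]; last exact: setUC.
have := set21 a b; have := set22 a b; rewrite E !inE.
have := set21 c d; have := set22 c d; rewrite -E !inE.
rewrite !(eq_sym c) !(eq_sym d).
by do 4!case: eqP => ?; subst; rewrite ?eqxx //=; auto.
Qed.

Lemma edge_adj_parent r f x y : parent_map r f ->
  edge_adj (parent_edges r f) x y
    = (x != r) && (f x == y) || (y != r) && (f y == x).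
Proof.
move=> pf; apply/andP/orP => [[_ /imsetP[z]]|[] /andP[ur /eqP<-]].
- rewrite !inE => zr /eqP; rewrite eq_set2.
  by case/orP=> /andP[/eqP-> /eqP->]; [left | right]; rewrite zr eqxx.
- rewrite eq_sym (parent_neq pf ur); split=> //.
  by apply/imsetP; exists x; rewrite // !inE.
- rewrite (parent_neq pf ur); split=> //.
  by apply/imsetP; exists y; rewrite 1?setUC // !inE.
Qed.

Lemma parent_edges_sub r f : parent_map r f -> parent_edges r f \subset edges G.
Proof.
move=> pf; apply/subsetP=> _ /imsetP[x + ->]; rewrite !inE => xr.
apply/existsP; exists x; apply/existsP; exists (f x).
by rewrite (parent_adj pf xr) eqxx.
Qed.

Lemma parent_edges_connected r f :
  parent_map r f -> connected (edge_subgraph (parent_edges r f)).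
Proof.
move=> pf; set H := edge_subgraph _; apply/andP; split.
  by apply/card_gt0P; exists r.
have toroot x : connect (@adj H) x r.
  move: x; apply: (parent_ind pf) => [|x xr]; first exact: connect0.
  apply/connect_trans/connect1.
  by rewrite /= (edge_adj_parent _ _ pf) xr eqxx.
apply/forallP => x; apply/forallP=> y; apply: connect_trans (toroot x) _.
by rewrite (sym_connect_sym (@adj_sym H)).
Qed.

(** In a cycle of tree edges, both neighbours of a deepest vertex would be its
parent, but the neighbours of a vertex in a cycle are distinct. *)
Lemma parent_edges_acyclic r f :
  parent_map r f -> acyclic (edge_subgraph (parent_edges r f)).
Proof.
move=> pf; apply/acyclicP => c c_gt2; apply/negP => /andP[cyc_c uniq_c].
have [x0 x0c] : exists x0, x0 \in c.
  by case: c c_gt2 {cyc_c uniq_c} => // x s; exists x; apply: mem_head.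
case: (@arg_maxnP _ x0 (mem c) (fun x => findex f x r) x0c) => x xc x_max.
have uphill y : y \in c -> edge_adj (parent_edges r f) x y -> y = f x.
  move=> yc; rewrite (edge_adj_parent _ _ pf) => /orP[/andP[_ /eqP//]|].
  case/andP=> yr /eqP fy; have := x_max y yc.
  by rewrite /= (parent_depth pf yr) fy ltnn.
have [i s rot_c] := rot_to xc.
have mem_s y : y \in s -> y \in c.
  by move=> ys; rewrite -(mem_rot i) rot_c inE ys orbT.
move: cyc_c uniq_c c_gt2.
rewrite -(rot_cycle i) -(rot_uniq i) -(size_rot i) rot_c.
case: s mem_s {rot_c} => // y s mem_s; case/lastP: s mem_s => // s z mem_s.
rewrite /= rcons_path last_rcons => /andP[xy /andP[_ zx]] /and3P[_ + _] _.
rewrite (uphill y) ?mem_s ?mem_head // -(uphill z) ?mem_rcons ?mem_head //.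
  by rewrite mem_s // inE mem_rcons mem_head orbT.
by rewrite edge_adj_sym.
Qed.

Lemma parent_edges_spanning r f :
  parent_map r f -> parent_edges r f \in spanning_trees G.
Proof.
move=> pf; rewrite inE parent_edges_sub //.
by rewrite /is_tree parent_edges_connected ?parent_edges_acyclic.
Qed.

(** Suppose that [f] and [g] have the same edges and agree at the parent [f x] but
not at [x]. The edge from [x] to [f x] must be used by [g] in the other
direction, so [f (f x) = g (f x) = x], which contradicts the decrease of depth. *)
Lemma parent_edges_inj r :
  {in [pred f | parent_map r f] &, injective (parent_edges r)}.
Proof.
move=> f g; rewrite !inE => pf pg eqE; apply/ffunP.
apply: (parent_ind pf) => [|x xr fgx].
  by rewrite (parent_root pf) (parent_root pg).
apply/eqP/negPn/negP => fg.
have edge_xf : edge_adj (parent_edges r g) x (f x).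
  by rewrite -eqE (edge_adj_parent _ _ pf) xr eqxx.
have edge_xg : edge_adj (parent_edges r f) x (g x).
  by rewrite eqE (edge_adj_parent _ _ pg) xr eqxx.
move: edge_xf edge_xg; rewrite (edge_adj_parent _ _ pf) (edge_adj_parent _ _ pg).
rewrite (negPf fg) (eq_sym (g x)) (negPf fg) !andbF /=.
case/andP=> fxr /eqP gfx /andP[gxr /eqP fgx'].
have := parent_depth pf fxr; rewrite fgx gfx (parent_depth pf xr).
by move/eqP; rewrite -addn2 -[X in X == _]addn0 eqn_add2l.
Qed.

(** Sending each vertex to a neighbour strictly closer to [r] in the tree defines
a parent map; an edge of the tree that this map does not use would close a cycle
with the path that joins its ends along the edges in use. *)
Lemma spanning_tree_parent r F :
  F \in spanning_trees G -> exists2 f, parent_map r f & F = parent_edges r f.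
Proof.
rewrite inE => /andP[subF /andP[/andP[_ /forallP conF] acF]].
pose e := @edge_adj G F.
have Fadj x y : e x y -> adj x y.
  case/andP=> _ /(subsetP subF); rewrite inE => /existsP[a /existsP[b]].
  case/andP=> ab; rewrite eq_set2 => /orP[]/andP[/eqP-> /eqP->] //.
  by rewrite adj_sym.
pose P x k := [exists p : k.-tuple G, path e x p && (last x p == r)].
have exP x : exists k, P x k.
  have /forallP/(_ r)/connectP[p xp lastp] := conF x.
  by exists (size p); apply/existsP; exists (in_tuple p); rewrite xp lastp /=.
pose d x := ex_minn (exP x).
have descend x : x != r -> exists y, e x y && (d y < d x).
  move=> xr; rewrite /d; case: (ex_minnP (exP x)) => -[|k] /existsP[p].
    by rewrite tuple0 /= (negPf xr).
  case/tupleP: p => y p /andP[/= /andP[xy yp] lastp] _; exists y; rewrite xy.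
  case: ex_minnP => k' _; rewrite ltnS; apply.
  by apply/existsP; exists p; rewrite yp.
pose f := [ffun x =>
  if x == r then x else odflt x [pick y | e x y && (d y < d x)]].
have fr : f r = r by rewrite ffunE eqxx.
have fP x : x != r -> e x (f x) && (d (f x) < d x).
  move=> xr; rewrite ffunE (negPf xr); case: pickP => //= none.
  by have [y] := descend x xr; rewrite none.
have pf : parent_map r f.
  apply/forallP => x; have [n] := ubnP (d x); elim: n x => // n IHn x.
  have [->|xr] := eqVneq x r; first by rewrite fr eqxx connect0.
  have /andP[exf dfx] := fP x xr; rewrite ltnS => /(leq_trans dfx)/IHn/andP[_ fxr].
  by rewrite Fadj //=; apply: connect_trans (fconnect1 f x) fxr.
have sub_fF : parent_edges r f \subset F.
  by apply/subsetP=> _ /imsetP[x + ->]; rewrite !inE => /fP/andP[/andP[]].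
exists f => //; apply/eqP; rewrite eqEsubset sub_fF andbT.
apply/subsetP=> A FA; have := subsetP subF A FA; rewrite inE.
case/existsP=> x /existsP[y /andP[xy /eqP defA]].
have x_neq_y : x != y by apply: contraTneq xy => ->; rewrite adj_irrefl.
apply: contraT => notfA.
have /andP[_ /forallP/(_ x)/forallP/(_ y)/connectP[p0 xp0 y0]] :=
  parent_edges_connected pf.
move: y0; case: (shortenP xp0) => p xp uniq_p _ lastp.
have/negP[] : ~~ ucycleb (@adj (edge_subgraph F)) (x :: p).
  apply: (acyclicP _ acF).
  case: p xp lastp {uniq_p} => [_ /eqP|z [|//]].
    by rewrite eq_sym (negPf x_neq_y).
  by rewrite /= andbT => /andP[_ +] yz; rewrite -yz -defA (negPf notfA).
rewrite /ucycleb uniq_p andbT /= rcons_path -lastp; apply/andP; split.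
  apply: sub_path xp => a b /andP[ab abF]; rewrite /= /edge_adj ab.
  exact: subsetP sub_fF _ abF.
by rewrite /= /edge_adj eq_sym x_neq_y setUC -defA.
Qed.

Theorem card_parent_maps r : #|[set f | parent_map r f]| = #|spanning_trees G|.
Proof.
rewrite -(card_in_imset (f := parent_edges r)); last first.
  by move=> f g; rewrite !inE => pf pg; apply: parent_edges_inj.
apply: eq_card => F.
apply/imsetP/idP => [[f + ->] | /(spanning_tree_parent r)[f pf ->]].
  by rewrite inE; apply: parent_edges_spanning.
by exists f; rewrite ?inE.
Qed.
End ParentMaps.

(** * A weighted matrix-tree theorem *)

Section MatrixTree.
Import GRing.Theory.
Local Open Scope ring_scope.

Definition degree (G : sgraph) (x : G) : nat := (\sum_(y : G) adj x y)%N.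

(** With ['X = t], this is det ((t + 1) D - A) for the degree matrix D and the
adjacency matrix A, that is det (L + t D) for the Laplacian L = D - A. Weighting
by D rather than the identity is what makes it factor for tensor products. *)
Definition laplacian_poly (R : comNzRingType) (G : sgraph) : {poly R} :=
  fdet (fun x y : G =>
    (y == x)%:R * ((degree x)%:R * ('X + 1)) - (adj x y)%:R : {poly R}).

Definition arc_weight (G : sgraph) (f : {ffun G -> G}) : nat :=
  (\prod_x (if f x == x then degree x else adj x (f x)))%N.

Lemma laplacian_polyE (R : comNzRingType) (G : sgraph) :
  laplacian_poly R G
    = \sum_(f : {ffun G -> G} | forest f)
        (arc_weight f)%:R * 'X^#|[set x | f x == x]|.
Proof.
pose w (x y : G) : {poly R} := (adj x y)%:R.
pose c (x : G) : {poly R} := (degree x)%:R * 'X.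
rewrite /laplacian_poly (@eq_fdet _ _ _ (fun x y =>
  (y == x)%:R * (c x + \sum_z w x z) - w x y)) => [|x y]; last first.
  by rewrite /c /w -natr_sum mulrDr mulr1.
rewrite fdet_rooted_forests; apply: eq_bigr => f _.
rewrite natr_prod.
rewrite (_ : 'X^_ = \prod_x (if f x == x then 'X else 1) :> {poly R}); last first.
  by rewrite -big_mkcond /= prodr_const cardsE.
rewrite -big_split; apply: eq_bigr => x _; rewrite /c /w.
by rewrite /=; case: ifP; rewrite ?mulr1.
Qed.

Lemma coef_laplacian_poly (R : comNzRingType) (G : sgraph) k :
  (laplacian_poly R G)`_k
    = (\sum_(f : {ffun G -> G} | forest f && (#|[set x | f x == x]| == k))
         arc_weight f)%:R.
Proof.
rewrite laplacian_polyE coef_sum natr_sum big_mkcondr /=; apply: eq_bigr => f _.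
by rewrite -polyC_natr coefCM coefXn eq_sym; case: eqP; rewrite ?mulr1 ?mulr0.
Qed.

Lemma laplacian_poly_coef0 (R : comNzRingType) (G : sgraph) (r : G) :
  (laplacian_poly R G)`_0 = 0.
Proof.
rewrite coef_laplacian_poly big_pred0 // => f; apply/negbTE/negP.
case/andP=> /forallP/(_ r)/existsP[x /andP[fx _]]; rewrite cards_eq0 => /eqP.
by move/setP/(_ x); rewrite !inE fx.
Qed.

(** The root is the only fixed point, since an edge is never a loop. *)
Lemma parent_map_fix (G : sgraph) (r : G) (f : {ffun G -> G}) :
  parent_map r f -> [set x | f x == x] = [set r].
Proof.
move=> pf; apply/setP=> x; rewrite !inE.
have [->|xr] := eqVneq x r; first by rewrite (parent_root pf) eqxx.
exact/negbTE/(parent_neq pf).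
Qed.

(** The product of the adjacency indicators over the vertices other than the
unique fixed point [r] tests whether a forest is a parent map rooted at [r]. *)
Lemma arc_weight_single_root (G : sgraph) (f : {ffun G -> G}) :
  ((forest f && (#|[set x | f x == x]| == 1)) * arc_weight f
    = \sum_r degree r * parent_map r f)%N.
Proof.
have [/cards1P[r fixf] | nfix] := boolP (#|_| == 1%N); last first.
  rewrite andbF mul0n big1 // => r _.
  have [/parent_map_fix fixf|_] := boolP (parent_map r f); last exact: muln0.
  by rewrite fixf cards1 in nfix.
have fixE x : (f x == x) = (x == r) by move/setP/(_ x): fixf; rewrite !inE.
rewrite andbT (bigD1 r) //= [X in (_ = _ + X)%N]big1 ?addn0; last first.
  move=> r' r'r.
  have [/parent_root/eqP|_] := boolP (parent_map r' f); last exact: muln0.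
  by rewrite fixE (negPf r'r).
rewrite /arc_weight (bigD1 r) //= fixE eqxx.
under eq_bigr => x xr do rewrite fixE (negPf xr).
have [pf | npf] := boolP (parent_map r f).
  have -> : forest f.
    apply/forallP => x; apply/existsP; exists r.
    by rewrite fixE eqxx; have /forallP/(_ x)/andP[] := pf.
  by rewrite mul1n big1 // => x /(parent_adj pf)->.
rewrite muln0; apply/eqP; apply: contraNT npf.
rewrite !muln_eq0 !negb_or eqb0 negbK.
case/and3P=> /forallP forf _; rewrite -lt0n => /gt0_prodn adjf.
apply/forallP => x; have /existsP[y] := forf x; rewrite fixE => /andP[/eqP-> ->].
case: eqVneq => [->|xr]; first by rewrite fixE eqxx.
by have := adjf x xr; rewrite lt0b => ->.
Qed.

(** Each spanning tree is counted once for every choice of its root, with the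
degree of the root as weight. *)
Theorem laplacian_poly_coef1 (R : comNzRingType) (G : sgraph) :
  (laplacian_poly R G)`_1
    = ((\sum_(x : G) degree x) * #|spanning_trees G|)%:R.
Proof.
rewrite coef_laplacian_poly; congr _%:R; rewrite big_mkcond /=.
transitivity (\sum_(f : {ffun G -> G}) \sum_(r : G) degree r * parent_map r f)%N.
  apply: eq_bigr => f _; rewrite -arc_weight_single_root.
  by case: (_ && _); rewrite ?mul1n ?mul0n.
rewrite exchange_big big_distrl /=; apply: eq_bigr => r _.
rewrite -big_distrr /= -(card_parent_maps r) -sum1_card; congr (_ * _)%N.
by rewrite [RHS]big_mkcond; apply: eq_bigr => f _; rewrite inE; case: parent_map.
Qed.

End MatrixTree.

(** * Determinants of bipartite block matrices *)

Section BipartiteDeterminants.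
Import GRing.Theory.
Local Open Scope ring_scope.

Definition bipartite_mx (R : comNzRingType) (A B : finType) (s : R)
    (M : A -> B -> R) (N : B -> A -> R) (x y : A + B) : R :=
  match x, y with
  | inl a, inl a' => (a' == a)%:R * s
  | inl a, inr b => - M a b
  | inr b, inl a => - N b a
  | inr b, inr b' => (b' == b)%:R * s
  end.

Lemma fdet_bipartite_swap (R : comNzRingType) (A B : finType) (s : R)
    (M : A -> B -> R) (N : B -> A -> R) :
  fdet (bipartite_mx s M N) = fdet (bipartite_mx s N M).
Proof.
pose h (x : B + A) : A + B := match x with inl b => inr b | inr a => inl a end.
pose k (x : A + B) : B + A := match x with inl b => inr b | inr a => inl a end.
rewrite (@fdet_reindex _ _ _ h); last by exists k; case.
by apply: eq_fdet => -[x|x] [y|y].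
Qed.

(** Multiply the block matrix on the right by the one with blocks 1, M, 0, s.
The form without division holds over any commutative ring. *)
Lemma det_schur (R : comNzRingType) k l (s : R)
    (M : 'M[R]_(k, l)) (N : 'M_(l, k)) :
  \det (block_mx s%:M (- M) (- N) s%:M) * s ^+ l
    = s ^+ k * \det ((s ^+ 2)%:M - N *m M).
Proof.
have <- : \det (block_mx 1%:M M 0 (s%:M : 'M[R]_l)) = s ^+ l.
  by rewrite det_ublock det1 mul1r det_scalar.
rewrite -det_mulmx mulmx_block !mulmx1 !mulmx0 !addr0.
rewrite mul_mx_scalar mul_scalar_mx scalerN subrr.
by rewrite det_lblock det_scalar -scalar_mxM expr2 mulNmx addrC.
Qed.

Lemma fdet_schur (R : comNzRingType) (A B : finType) (s : R)
    (M : A -> B -> R) (N : B -> A -> R) :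
  fdet (bipartite_mx s M N) * s ^+ #|B|
    = s ^+ #|A|
      * fdet (fun b b' => (b' == b)%:R * s ^+ 2 - \sum_a N b a * M a b').
Proof.
pose g (i : 'I_(#|A| + #|B|)) : A + B :=
  match split i with inl a => inl (enum_val a) | inr b => inr (enum_val b) end.
pose g' (x : A + B) : 'I_(#|A| + #|B|) :=
  match x with
  | inl a => lshift _ (enum_rank a)
  | inr b => rshift _ (enum_rank b)
  end.
have bij_g : bijective g.
  exists g' => [i | [a|b]]; rewrite /g /g'.
  - by case: split_ordP => j ->; rewrite enum_valK.
  - by rewrite -/(unsplit (inl _)) unsplitK enum_rankK.
  - by rewrite -/(unsplit (inr _)) unsplitK enum_rankK.
pose M' := \matrix_(i < #|A|, j < #|B|) M (enum_val i) (enum_val j).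
pose N' := \matrix_(i < #|B|, j < #|A|) N (enum_val i) (enum_val j).
have delta (T : finType) (i j : 'I_#|T|) (t : R) :
  (enum_val j == enum_val i)%:R * t = t *+ (i == j).
  by rewrite (inj_eq enum_val_inj) eq_sym mulr_natl.
rewrite (fdet_enum _ bij_g).
rewrite (_ : (\matrix_(i, j) _) = block_mx s%:M (- M') (- N') s%:M); last first.
  apply/matrixP => i j; rewrite mxE /g.
  case: (split_ordP i) => i' ->; case: (split_ordP j) => j' ->;
  by rewrite ?block_mxEul ?block_mxEur ?block_mxEdl ?block_mxEdr !mxE //= delta.
rewrite det_schur /fdet; congr (_ * \det _); apply/matrixP => i j.
rewrite !mxE delta; congr (_ - _).
rewrite [RHS](reindex _ (onW_bij _ (enum_val_bij A))).
by apply: eq_bigr => a _; rewrite !mxE.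
Qed.

End BipartiteDeterminants.

(** * Random walks on tensor products of bipartite graphs *)

Section TensorDeterminants.
Import GRing.Theory.
Local Open Scope ring_scope.

Lemma sum_pair_mul (R : pzSemiRingType) (A B : finType)
    (F : A -> R) (H : B -> R) :
  \sum_(x : A * B) F x.1 * H x.2 = (\sum_a F a) * (\sum_b H b).
Proof. by rewrite big_distrlr /= pair_bigA. Qed.

(** The two sides come from the biadjacency pairs x.y, x'.y' and x.y', x'.y (a dot
standing for the tensor product). Taking Schur complements onto Q x Q' on the
left and P x Q' on the right, both reduce to the return matrix y'y on Q',
tensored with x'x on Q and with xx' on P respectively. The auxiliary pair
x.1, x'.(y'y) has these two as its two Schur complements, so they differ by a
power of [s]. *)
Lemma fdet_tensor (R : idomainType) (P Q P' Q' : finType) (s : R)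
    (x : P -> Q -> R) (x' : Q -> P -> R)
    (y : P' -> Q' -> R) (y' : Q' -> P' -> R) :
    s != 0 ->
  fdet (bipartite_mx s
     (fun (a : P * P') (b : Q * Q') => x a.1 b.1 * y a.2 b.2)
     (fun b a => x' b.1 a.1 * y' b.2 a.2)) * s ^+ (#|P| * #|Q'| + #|Q| * #|P'|)
  = s ^+ (#|P| * #|P'| + #|Q| * #|Q'|) * fdet (bipartite_mx s
     (fun (a : P * Q') (b : Q * P') => x a.1 b.1 * y' a.2 b.2)
     (fun b a => x' b.1 a.1 * y b.2 a.2)).
Proof.
move=> s_neq0; set E := fdet _; set O := fdet _.
pose xx q r := \sum_p x' q p * x p r.
pose xx' p r := \sum_q x p q * x' q r.
pose yy q r := \sum_p y' q p * y p r.
pose DQ := fdet (fun b b' : Q * Q' =>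
  (b' == b)%:R * s ^+ 2 - xx b.1 b'.1 * yy b.2 b'.2).
pose DP := fdet (fun a a' : P * Q' =>
  (a' == a)%:R * s ^+ 2 - xx' a.1 a'.1 * yy a.2 a'.2).
have eqE : E * s ^+ (#|Q| * #|Q'|) = s ^+ (#|P| * #|P'|) * DQ.
  rewrite -!card_prod fdet_schur; congr (_ * _); apply: eq_fdet => b b'.
  rewrite -sum_pair_mul; congr (_ - _); apply: eq_bigr => a _; exact: mulrACA.
have eqO : O * s ^+ (#|P| * #|Q'|) = s ^+ (#|Q| * #|P'|) * DP.
  rewrite -!card_prod /O fdet_bipartite_swap fdet_schur; congr (_ * _).
  apply: eq_fdet => b b'.
  rewrite -sum_pair_mul; congr (_ - _); apply: eq_bigr => a _; exact: mulrACA.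
pose N (b : Q * Q') (a : P * Q') := x' b.1 a.1 * yy b.2 a.2.
pose M (a : P * Q') (b : Q * Q') := x a.1 b.1 * (a.2 == b.2)%:R.
have sum_delta (F : Q' -> R) q : \sum_r F r * (r == q)%:R = F q.
  rewrite (bigD1 q) //= eqxx mulr1 big1 ?addr0 // => r /negPf->; exact: mulr0.
have sum_delta' (F : Q' -> R) q : \sum_r (r == q)%:R * F r = F q.
  by under eq_bigr do rewrite mulrC; apply: sum_delta.
have eqD1 : fdet (bipartite_mx s M N) * s ^+ (#|Q| * #|Q'|)
    = s ^+ (#|P| * #|Q'|) * DQ.
  rewrite -!card_prod fdet_schur; congr (_ * _); apply: eq_fdet => b b'.
  rewrite -[yy _ _](sum_delta (yy b.2)) -sum_pair_mul; congr (_ - _).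
  by apply: eq_bigr => a _; exact: mulrACA.
have eqD2 : fdet (bipartite_mx s M N) * s ^+ (#|P| * #|Q'|)
    = s ^+ (#|Q| * #|Q'|) * DP.
  rewrite -!card_prod fdet_bipartite_swap fdet_schur; congr (_ * _).
  apply: eq_fdet => a a'.
  rewrite -[yy _ _](sum_delta' (yy^~ a'.2)) -sum_pair_mul; congr (_ - _).
  by apply: eq_bigr => b _; rewrite /M eq_sym; exact: mulrACA.
(* E, DQ, DP and O are successively related by powers of s, which cancel *)
apply: (mulIf (expf_neq0 (#|Q| * #|Q'| + #|P| * #|Q'|) s_neq0)).
rewrite !exprD; move: (fdet (bipartite_mx s M N)) eqD1 eqD2 => Z.
move: (s ^+ (#|Q| * #|Q'|)) (s ^+ (#|P| * #|P'|)) eqE => e p eqE.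
move: (s ^+ (#|P| * #|Q'|)) (s ^+ (#|Q| * #|P'|)) eqO => u v eqO eqD1 eqD2.
transitivity (E * e * u * u * v); first by ring.
transitivity (p * v * (u * DQ) * u); first by rewrite eqE; ring.
rewrite -eqD1; transitivity (p * v * e * (Z * u)); first by ring.
rewrite eqD2; transitivity (p * e * e * (v * DP)); first by ring.
by rewrite -eqO; ring.
Qed.

End TensorDeterminants.

Section TensorGraphs.
Import GRing.Theory.
Local Open Scope ring_scope.

(** The characteristic polynomial of the random walk on [G], taken at ['X + 1]. *)
Definition normalized_poly (G : sgraph) : {poly rat} :=
  fdet (fun x y : G =>
    (y == x)%:R * ('X + 1) - ((adj x y)%:R / (degree x)%:R)%:P).

Lemma laplacian_poly_normalized (G : sgraph) :
    (forall x : G, 0 < degree x)%N ->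
  laplacian_poly rat G = (\prod_(x : G) degree x)%:R * normalized_poly G.
Proof.
move=> deg_gt0; rewrite natr_prod -fdet_scale_rows; apply: eq_fdet => x y.
rewrite mulrBr mulrCA; congr (_ - _).
rewrite -!polyC_natr -polyCM mulrC divfK //.
by rewrite Num.Theory.pnatr_eq0 -lt0n.
Qed.

Definition bdegree (A B : finType) (K : A -> B -> bool) (a : A) : nat :=
  (\sum_b K a b)%N.

Definition flip (A B : Type) (K : A -> B -> bool) (b : B) (a : A) := K a b.

Definition step_prob (A B : finType) (K : A -> B -> bool) (a : A) (b : B) :
    {poly rat} :=
  ((K a b)%:R / (bdegree K a)%:R)%:P.

(** A single bipartite pattern covers both components of the product of two
bipartite graphs: replacing [H] by [flip H] gives the other component. *)
Definition tensor_adj (A B C D : finType)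
    (K : A -> B -> bool) (H : C -> D -> bool) (x y : (A * C) + (B * D)) : bool :=
  match x, y with
  | inl a, inr b | inr b, inl a => K a.1 b.1 && H a.2 b.2
  | _, _ => false
  end.

Lemma sum_pair_muln (A B : finType) (F : A -> nat) (H : B -> nat) :
  (\sum_(x : A * B) F x.1 * H x.2 = (\sum_a F a) * (\sum_b H b))%N.
Proof. by rewrite big_distrlr /= pair_bigA. Qed.

Definition represents (A B C D : finType) (G : sgraph)
    (K : A -> B -> bool) (H : C -> D -> bool) (h : (A * C) + (B * D) -> G) :=
  bijective h /\ forall x y, adj (h x) (h y) = tensor_adj K H x y.

Definition tensor_degree (A B C D : finType) (K : A -> B -> bool)
    (H : C -> D -> bool) (x : (A * C) + (B * D)) : nat :=
  match x with
  | inl a => bdegree K a.1 * bdegree H a.2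
  | inr b => bdegree (flip K) b.1 * bdegree (flip H) b.2
  end%N.

Section Represented.
Variables (A B C D : finType) (G : sgraph).
Variables (K : A -> B -> bool) (H : C -> D -> bool) (h : (A * C) + (B * D) -> G).
Hypothesis hP : represents K H h.

Lemma degree_tensor x : degree (h x) = tensor_degree K H x.
Proof.
have [bij_h adj_h] := hP; rewrite /degree (reindex _ (onW_bij _ bij_h)) /=.
under eq_bigr do rewrite adj_h; rewrite big_sumType /=.
case: x => x /=; [rewrite big1 // add0n | rewrite [X in (_ + X)%N]big1 // addn0];
  by rewrite -[RHS]sum_pair_muln; apply: eq_bigr => z _; rewrite -mulnb.
Qed.

Lemma big_represented (R : Type) (idx : R) (op : Monoid.com_law idx)
    (F : nat -> R) :
  \big[op/idx]_(x : G) F (degree x)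
    = op (\big[op/idx]_(a : A * C) F (bdegree K a.1 * bdegree H a.2)%N)
         (\big[op/idx]_(b : B * D)
            F (bdegree (flip K) b.1 * bdegree (flip H) b.2)%N).
Proof.
have [bij_h _] := hP; rewrite (reindex _ (onW_bij _ bij_h)) /=.
by under eq_bigr do rewrite degree_tensor; rewrite big_sumType.
Qed.

Lemma sum_bdegree_flip (A' B' : finType) (K' : A' -> B' -> bool) :
  (\sum_b bdegree (flip K') b = \sum_a bdegree K' a)%N.
Proof. exact: exchange_big. Qed.

(** Both parts contribute the product of the numbers of edges of the factors, so
that flipping a factor does not change the sum of the degrees. *)
Lemma sum_degree_tensor :
  (\sum_(x : G) degree x = 2 * ((\sum_a bdegree K a) * (\sum_c bdegree H c)))%N.
Proof.
rewrite (big_represented _ id) /=.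
by rewrite !sum_pair_muln (sum_bdegree_flip K) (sum_bdegree_flip H) addnn mul2n.
Qed.

Lemma prod_degree_tensor :
  (\prod_(x : G) degree x
    = (\prod_a bdegree K a) ^ #|C| * (\prod_c bdegree H c) ^ #|A|
      * ((\prod_b bdegree (flip K) b) ^ #|D|
         * (\prod_d bdegree (flip H) d) ^ #|B|))%N.
Proof.
have prod_pair (S T : finType) (u : S -> nat) (v : T -> nat) :
    (\prod_(x : S * T) (u x.1 * v x.2)
      = (\prod_s u s) ^ #|T| * (\prod_t v t) ^ #|S|)%N.
  rewrite -(pair_bigA _ (fun s t => u s * v t)%N) /=.
  under eq_bigr do rewrite big_split prod_nat_const /=.
  rewrite big_split prod_nat_const /=; congr (_ * _)%N; symmetry.
  exact: (big_morph (expn^~ _) (fun a b => expnMn a b _) (exp1n _)).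
by rewrite (big_represented _ id) /= !prod_pair.
Qed.

Lemma normalized_poly_tensor :
  normalized_poly G = fdet (bipartite_mx ('X + 1)
     (fun a b => step_prob K a.1 b.1 * step_prob H a.2 b.2)
     (fun b a => step_prob (flip K) b.1 a.1 * step_prob (flip H) b.2 a.2)).
Proof.
have [bij_h adj_h] := hP; rewrite /normalized_poly (fdet_reindex _ bij_h).
apply: eq_fdet => x y; rewrite adj_h degree_tensor (inj_eq (bij_inj bij_h)).
case: x y => [a|b] [a'|b'] /=; rewrite ?mul0r ?subr0 ?sub0r //.
- by rewrite /step_prob -polyCM -mulnb !natrM invfM mulrACA.
- by rewrite /step_prob -polyCM -mulnb !natrM invfM mulrACA.
Qed.

End Represented.

(** The unbalance by one vertex in each factor makes the two characteristic
polynomials of the walks differ by exactly one factor ['X + 1]. *)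
Theorem spanning_trees_tensor_flip (P Q P' Q' : finType) (X : P -> Q -> bool)
    (Y : P' -> Q' -> bool) (G G' : sgraph)
    (h : (P * P') + (Q * Q') -> G) (h' : (P * Q') + (Q * P') -> G') :
    represents X Y h -> represents X (flip Y) h' ->
    #|P| = #|Q|.+1 -> #|P'| = #|Q'|.+1 ->
    (forall p, 0 < bdegree X p)%N -> (forall q, 0 < bdegree (flip X) q)%N ->
    (forall p, 0 < bdegree Y p)%N -> (forall q, 0 < bdegree (flip Y) q)%N ->
  ((\prod_(x : G) degree x) * #|spanning_trees G'|
    = (\prod_(x : G') degree x) * #|spanning_trees G|)%N.
Proof.
move=> hG hG' cardP cardP' X_gt0 X'_gt0 Y_gt0 Y'_gt0.
have degG_gt0 (x : G) : (0 < degree x)%N.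
  have [[k _ hK] _] := hG; rewrite -(hK x) (degree_tensor hG).
  by case: (k x) => z; rewrite /= muln_gt0 ?X_gt0 ?X'_gt0 ?Y_gt0 ?Y'_gt0.
have degG'_gt0 (x : G') : (0 < degree x)%N.
  have [[k _ hK] _] := hG'; rewrite -(hK x) (degree_tensor hG').
  by case: (k x) => z; rewrite /= muln_gt0 ?X_gt0 ?X'_gt0 ?Y'_gt0 ?Y_gt0.
have s_neq0 : 'X + 1 != 0 :> {poly rat} by rewrite -size_poly_eq0 size_XaddC.
have norm : normalized_poly G = ('X + 1) * normalized_poly G'.
  rewrite (normalized_poly_tensor hG) (normalized_poly_tensor hG').
  apply: (mulIf (expf_neq0 (#|P| * #|Q'| + #|Q| * #|P'|) s_neq0)).
  rewrite fdet_tensor // mulrAC -exprS cardP cardP'; congr (_ ^+ _ * _); lia.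
have lapl : laplacian_poly rat G * (\prod_(x : G') degree x)%:R
    = ('X + 1) * laplacian_poly rat G' * (\prod_(x : G) degree x)%:R.
  by rewrite !laplacian_poly_normalized // norm; ring.
have [p0 _] : exists p0 : P, p0 \in P by apply/card_gt0P; rewrite cardP.
have [p1 _] : exists p1 : P', p1 \in P' by apply/card_gt0P; rewrite cardP'.
pose S := ((\sum_a bdegree X a) * (\sum_c bdegree Y c))%N.
have S_gt0 : (0 < 2 * S)%N.
  rewrite !muln_gt0 (bigD1 p0) // (bigD1 p1) //= !addn_gt0.
  by rewrite X_gt0 Y_gt0.
have sumG : (\sum_(x : G) degree x = 2 * S)%N by rewrite (sum_degree_tensor hG).
have sumG' : (\sum_(x : G') degree x = 2 * S)%N.
  by rewrite (sum_degree_tensor hG') (sum_bdegree_flip Y).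
have coef0 : (laplacian_poly rat G')`_0 = 0.
  suff /card_gt0P[r' _] : (0 < #|G'|)%N by apply: laplacian_poly_coef0 r'.
  rewrite lt0n; apply: contraTneq S_gt0 => G'0.
  by rewrite -sumG' big1 // => x; have := card0_eq G'0 x.
clearbody S.
(* since the constant coefficient for G' vanishes, the factor 'X + 1 does not
   affect the linear coefficient *)
move/(congr1 (fun p : {poly rat} => p`_1)): lapl.
rewrite -!polyC_natr !coefMC mulrDl mul1r coefD coefXM /= coef0.
rewrite add0r !laplacian_poly_coef1 sumG sumG' -!natrM => /eqP.
rewrite Num.Theory.eqr_nat -2!(mulnA (2 * S)) eqn_pmul2l // => /eqP eq_tau.
by rewrite mulnC -eq_tau mulnC.
Qed.

End TensorGraphs.

(** * Checkerboard graphs as tensor products of paths *)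

Section DoublePath.
Variable a : nat.

(** Biadjacency of the path on [a.+1.*2.+1] vertices: counting from 0, the vertex
[j.*2.+1] is joined to [j.*2] and [j.+1.*2]. *)
Definition path_bip (i : 'I_a.+2) (j : 'I_a.+1) : bool :=
  (i == j :> nat) || (i == j.+1 :> nat).

Definition coord (u : 'I_a.+2 + 'I_a.+1) : 'I_(a.+1.*2.+1) :=
  match u with inl i => inord i.*2 | inr j => inord j.*2.+1 end.

#[local] Arguments coord : simpl never.

Definition uncoord (x : 'I_(a.+1.*2.+1)) : 'I_a.+2 + 'I_a.+1 :=
  if odd x then inr (inord x./2) else inl (inord x./2).

Lemma val_coord u :
  coord u = match u with inl i => i.*2 | inr j => j.*2.+1 end :> nat.
Proof.
case: u => z; have := ltn_ord z; rewrite /coord => z_lt; rewrite inordK //; lia.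
Qed.

Lemma coordK : cancel coord uncoord.
Proof.
move=> u; rewrite /uncoord val_coord; case: u => [i|j] /=.
  by rewrite odd_double doubleK inord_val.
by rewrite odd_double uphalf_double inord_val.
Qed.

Lemma uncoordK : cancel uncoord coord.
Proof.
move=> x; apply: val_inj; rewrite /= val_coord /uncoord.
have := ltn_ord x; case: ifP => [x_odd | x_even] x_lt /=; rewrite inordK; lia.
Qed.

Lemma odd_coord u : odd (coord u) = if u is inr _ then true else false.
Proof. by rewrite val_coord; case: u => z /=; rewrite odd_double. Qed.

Definition path_adj u v : bool :=
  match u, v with
  | inl i, inr j | inr j, inl i => path_bip i j
  | _, _ => false
  end.

Lemma dist_coord u v :
  (`|(coord u).+1 - (coord v).+1|%N == 1) = path_adj u v.
Proof.
rewrite !val_coord; case: u v => [i|i] [j|j]; rewrite /= /path_bip; lia.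
Qed.

Lemma sum_eq_ord n k : \sum_(j < n) (k == j :> nat) = (k < n).
Proof.
have [k_lt | n_le] := ltnP k n.
  rewrite (bigD1 (Ordinal k_lt)) //= eqxx big1 // => j.
  by rewrite -val_eqE eq_sym /= => /negPf->.
by rewrite big1 // => j _; have := ltn_ord j; lia.
Qed.

Lemma path_bip_addn i j :
  path_bip i j = (i == j :> nat) + (i == j.+1 :> nat) :> nat.
Proof. by rewrite /path_bip; lia. Qed.

Lemma bdegree_path_bip i : bdegree path_bip i = (i <= a) + (0 < i).
Proof.
rewrite /bdegree; under eq_bigr do rewrite path_bip_addn.
rewrite big_split /= sum_eq_ord ltnS; congr (_ + _).
have := ltn_ord i; case: (nat_of_ord i) => [|k] k_lt; first by rewrite big1.
by under eq_bigr do rewrite eqSS; rewrite sum_eq_ord -ltnS k_lt.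
Qed.

Lemma bdegree_path_bip_flip j : bdegree (flip path_bip) j = 2.
Proof.
rewrite /bdegree /flip; under eq_bigr do rewrite path_bip_addn.
under eq_bigr do rewrite eq_sym [X in _ + nat_of_bool X]eq_sym.
have j_lt := ltn_ord j.
by rewrite big_split /= !sum_eq_ord ltnS ltnW // ltnS j_lt.
Qed.

Lemma prod_bdegree_path_bip : \prod_i bdegree path_bip i = 2 ^ a.
Proof.
under eq_bigr do rewrite bdegree_path_bip.
rewrite big_ord_recl big_ord_recr /= ltnn mul1n muln1.
rewrite (eq_bigr (fun=> 2)) => [|i _]; first by rewrite prod_nat_const card_ord.
by rewrite /= ltn_ord.
Qed.

Lemma prod_bdegree_path_bip_flip : \prod_j bdegree (flip path_bip) j = 2 ^ a.+1.
Proof.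
under eq_bigr do rewrite bdegree_path_bip_flip.
by rewrite prod_nat_const card_ord.
Qed.
End DoublePath.

Arguments coord {a} u : simpl never.

Section Checkerboard.
Variables a b : nat.
Local Notation m := a.+1.*2.+1.
Local Notation n := b.+1.*2.+1.

Lemma represents_EC :
  exists h : ('I_a.+2 * 'I_b.+2) + ('I_a.+1 * 'I_b.+1) -> EC m n,
    represents (@path_bip a) (@path_bip b) h.
Proof.
pose c (u : ('I_a.+2 * 'I_b.+2) + ('I_a.+1 * 'I_b.+1)) : 'I_m * 'I_n :=
  match u with
  | inl p => (coord (inl p.1), coord (inl p.2))
  | inr q => (coord (inr q.1), coord (inr q.2))
  end.
have c_even u : ~~ odd (coordx (c u) + coordy (c u)).
  by rewrite /coordx /coordy oddD; case: u => u; rewrite /= !odd_coord.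
pose k (v : EC m n) : ('I_a.+2 * 'I_b.+2) + ('I_a.+1 * 'I_b.+1) :=
  match uncoord (val v).1, uncoord (val v).2 with
  | inl p, inl p' => inl (p, p')
  | inr q, inr q' => inr (q, q')
  (* mixed parities do not occur in EC: any value does *)
  | _, _ => inl (ord0, ord0)
  end.
exists (fun u => exist _ (c u) (c_even u)); split.
  exists k => [[[p p']|[q q']] | [[x y] xy]]; rewrite /k /= ?coordK //.
  apply: val_inj => /=; move: xy; rewrite /coordx /coordy /=.
  rewrite -{1}[x]uncoordK -{1}[y]uncoordK oddD /= !odd_coord.
  case xE: (uncoord x) => [i|i]; case yE: (uncoord y) => [j|j] //= _;
  by rewrite -xE -yE !uncoordK.
move=> u v; rewrite /= /induced_adj /= /diag_adj /coordx /coordy.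
by case: u v => u [] v; rewrite /= !dist_coord.
Qed.

Lemma represents_OC :
  exists h : ('I_a.+2 * 'I_b.+1) + ('I_a.+1 * 'I_b.+2) -> OC m n,
    represents (@path_bip a) (flip (@path_bip b)) h.
Proof.
pose c (u : ('I_a.+2 * 'I_b.+1) + ('I_a.+1 * 'I_b.+2)) : 'I_m * 'I_n :=
  match u with
  | inl p => (coord (inl p.1), coord (inr p.2))
  | inr q => (coord (inr q.1), coord (inl q.2))
  end.
have c_odd u : odd (coordx (c u) + coordy (c u)).
  by rewrite /coordx /coordy oddD; case: u => u; rewrite /= !odd_coord.
pose k (v : OC m n) : ('I_a.+2 * 'I_b.+1) + ('I_a.+1 * 'I_b.+2) :=
  match uncoord (val v).1, uncoord (val v).2 with
  | inl p, inr q' => inl (p, q')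
  | inr q, inl p' => inr (q, p')
  (* equal parities do not occur in OC: any value does *)
  | _, _ => inl (ord0, ord0)
  end.
exists (fun u => exist _ (c u) (c_odd u)); split.
  exists k => [[[p p']|[q q']] | [[x y] xy]]; rewrite /k /= ?coordK //.
  apply: val_inj => /=; move: xy; rewrite /coordx /coordy /=.
  rewrite -{1}[x]uncoordK -{1}[y]uncoordK oddD /= !odd_coord.
  case xE: (uncoord x) => [i|i]; case yE: (uncoord y) => [j|j] //= _;
  by rewrite -xE -yE !uncoordK.
move=> u v; rewrite /= /induced_adj /= /diag_adj /coordx /coordy.
by case: u v => u [] v; rewrite /= !dist_coord.
Qed.
End Checkerboard.

Theorem corollary2 (m n : nat) (hm : 2 <= m) (hn : 2 <= n)
    (om : odd m) (on : odd n) :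
  #|spanning_trees (OC m n)| = 4 * #|spanning_trees (EC m n)|.
Proof.
(* m and n are at least 3, so the parts are indexed by nonempty ordinals *)
have odd_form k : 2 <= k -> odd k -> exists l, k = l.+1.*2.+1.
  by move=> k2 ok; exists k./2.-1; lia.
have [a ->] := odd_form m hm om; have [b ->] := odd_form n hn on.
have [h hEC] := represents_EC a b; have [h' hOC] := represents_OC a b.
have deg1 c (p : 'I_c.+2) : 0 < bdegree (@path_bip c) p.
  by rewrite bdegree_path_bip; lia.
have deg2 c (q : 'I_c.+1) : 0 < bdegree (flip (@path_bip c)) q.
  by rewrite bdegree_path_bip_flip.
have := spanning_trees_tensor_flip hEC hOC; rewrite !card_ord.
move=> /(_ erefl erefl (deg1 a) (deg2 a) (deg1 b) (deg2 b)).
rewrite (prod_degree_tensor hEC) (prod_degree_tensor hOC) !card_ord.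
rewrite -[bdegree (flip (flip _))]/(bdegree _).
rewrite !prod_bdegree_path_bip !prod_bdegree_path_bip_flip -!expnM -!expnD.
set e := (X in 2 ^ X * _ = _); set e' := (X in _ = 2 ^ X * _).
have -> : e' = e + 2 by rewrite /e /e'; lia.
by rewrite expnD -mulnA => /eqP; rewrite eqn_pmul2l ?expn_gt0 // => /eqP.
Qed.
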